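(* Let $\eta\in(0,1)$ and $K\ge1$. There exists a constant $A\ge1$ depending only on $\eta$ and $K$ such that for all positive integers $s_1\le d_1$, $s_2\le d_2$ satisfying 1. $e\le \frac{d_1}{s_1}\wedge\frac{d_2}{s_2}$, 2. $\dfrac{\log\log(d_1/s_1)}{\log(d_2/s_2)}\vee\dfrac{\log\log(d_2/s_2)}{\log(d_1/s_1)}\le 1$, 3. $K^{-1}\,s_2\log(d_2/s_2)\le s_1\log(d_1/s_1)\le K\,s_2\log(d_2/s_2)$, the minimax separation rate $\mu^*$ satisfies $$A^{-1}\rho\ \le\ (\mu^* )^2\ \le\ A\,\rho,\qquad \rho:=\frac{d_1d_2}{s_1^2s_2^2}\wedge\Big(\frac1{s_2}\log\Big(\frac{d_1}{s_1}\Big)+\frac1{s_1}\log\Big(\frac{d_2}{s_2}\Big)\Big).$$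
   Context: $\mathcal P_k(n)$ is the set of subsets of $[n]=\{1,\dots,n\}$ of cardinality $k$; $a\wedge b=\min\{a,b\}$, $a\vee b=\max\{a,b\}$. One observes $\mathbf Y=\mathbf X+\mathbf E\in\mathbb R^{d_1\times d_2}$ with $\mathbf X$ deterministic and $\mathbf E$ having i.i.d. $N(0,1)$ entries; $\mathbb P_{\mathbf X}$ denotes the law of $\mathbf Y$, and $\mathbb P_0$ the law for $\mathbf X=0$. For $\mu>0$, $\Theta(s_1,s_2,d_1,d_2,\mu)$ is the set of matrices $\mathbf M\in\mathbb R^{d_1\times d_2}$ for which there exist $S_1\in\mathcal P_{s_1}(d_1)$, $S_2\in\mathcal P_{s_2}(d_2)$ with $\mathbf M_{ij}\ge\mu$ for $(i,j)\in S_1\times S_2$ and $\mathbf M_{ij}=0$ otherwise. A test is a measurable $\{0,1\}$-valued function $\Delta$ of $\mathbf Y$, with risk $\mathcal R(\Delta,\mu)=\mathbb P_0(\Delta=1)+\sup_{\mathbf X\in\Theta(s_1,s_2,d_1,d_2,\mu)}\mathbb P_{\mathbf X}(\Delta=0)$. The minimax separation rate at level $\eta$ is $\mu^*=\mu^*(s_1,s_2,d_1,d_2)=\inf\{\mu>0:\inf_\Delta\mathcal R(\Delta,\mu)<\eta\}$, the inner infimum being over all tests. *)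

(* Defs.v *)
From HB Require Import structures.
From mathcomp Require Import all_boot all_order all_algebra.
From mathcomp Require Import all_classical all_reals all_analysis.

Set Implicit Arguments.
Unset Strict Implicit.
Unset Printing Implicit Defensive.

Import Order.TTheory GRing.Theory Num.Theory.
Import numFieldNormedType.Exports.

Local Open Scope classical_set_scope.
Local Open Scope ring_scope.

Definition measure_matrix_display : measure_display -> measure_display.
Proof. exact. Qed.

Section measurable_matrix.
Context d (T : measurableType d) (m n : nat).

(* The product sigma-algebra, i.e. the one generated by the coefficients; for
   [T := R] this is the Borel sigma-algebra. *)
Definition matrix_measurable : set (set 'M[T]_(m, n)) :=
  <<s \bigcup_(ij : 'I_m * 'I_n)
        preimage_set_system setT (fun M : 'M[T]_(m, n) => M ij.1 ij.2)
          measurable >>.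

Let matrix_measurable0 : matrix_measurable set0.
Proof. exact: sigma_algebra0. Qed.

Let matrix_measurableC A : matrix_measurable A -> matrix_measurable (~` A).
Proof. exact: sigma_algebraC. Qed.

Let matrix_measurable_bigcup (F : _^nat) :
  (forall i, matrix_measurable (F i)) -> matrix_measurable (\bigcup_i F i).
Proof. exact: sigma_algebra_bigcup. Qed.

HB.instance Definition _ := @isMeasurable.Build (measure_matrix_display d)
  'M[T]_(m, n) matrix_measurable matrix_measurable0 matrix_measurableC
  matrix_measurable_bigcup.

End measurable_matrix.

Section measurable_matrix_theory.
Context d d' (T : measurableType d) (T' : measurableType d') (m n : nat).

Lemma measurable_coeff (i : 'I_m) (j : 'I_n) :
  measurable_fun [set: 'M[T]_(m, n)] (fun M : 'M[T]_(m, n) => M i j).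
Proof.
move=> _ Y mY; rewrite setTI; apply: sub_sigma_algebra.
by exists (i, j) => //; exists Y => //; rewrite setTI.
Qed.

Lemma measurable_fun_matrixP (f : T' -> 'M[T]_(m, n)) :
  measurable_fun [set: T'] f <->
  forall i j, measurable_fun [set: T'] (fun x => f x i j).
Proof.
split=> [mf i j|mf _ Y mY].
  exact: (measurableT_comp (measurable_coeff i j) mf).
suff h : @measurable _ 'M[T]_(m, n) `<=` image_set_system setT f measurable.
  exact: (h _ mY).
apply: smallest_sub; first exact/sigma_algebra_image/sigma_algebra_measurable.
move=> _ [[i j] _ [B mB <-]]; rewrite /image_set_system/= setTI.
exact: mf.
Qed.

End measurable_matrix_theory.

Section iid.
Context d (T : measurableType d) (R : realType) (P : probability T R).

Definition tuple_cons n (x : T * n.-tuple T) : n.+1.-tuple T :=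
  [tuple of x.1 :: x.2].

Lemma measurable_tuple_cons n : measurable_fun setT (@tuple_cons n).
Proof. exact: measurable_cons. Qed.

HB.instance Definition _ n :=
  isMeasurableFun.Build _ _ _ _ (@tuple_cons n) (@measurable_tuple_cons n).

(* The n-fold product measure of [P]; see [iid_prob_box]. *)
Fixpoint iid_prob n : probability (n.-tuple T) R :=
  if n isn't n'.+1 then \d_[tuple]
  else distribution (P \x iid_prob n')%E (@tuple_cons n').

Lemma iid_prob_box n (B : 'I_n -> set T) : (forall i, measurable (B i)) ->
  iid_prob n [set t | forall i, B i (tnth t i)] = (\prod_(i < n) P (B i))%E.
Proof.
elim: n B => [|n IHn] B mB.
  rewrite big_ord0/= [LHS]diracE mem_set//; by case.
rewrite big_ord_recl -(IHn (fun i => B (lift ord0 i)))//=.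
rewrite /distribution/= /pushforward.
rewrite (_ : _ @^-1` _ =
    B ord0 `*` [set t | forall i, B (lift ord0 i) (tnth t i)]); last first.
  apply/seteqP; split=> -[x t] /=.
    move=> h; split; first exact: (h ord0).
    by move=> i; have := h (lift ord0 i); rewrite tnthS.
  move=> [B0 h] i; case: (unliftP ord0 i) => [j|] ->; last exact: B0.
  by rewrite tnthS.
rewrite product_measure1E//.
rewrite (_ : [set t | _] =
  \bigcap_(i in [set` finset.setT]) ((@tnth _ T ^~ i) @^-1` B (lift ord0 i))).
  apply: fin_bigcap_measurable => // i _.
  by rewrite -[X in measurable X]setTI; exact: measurable_tnth.
apply/seteqP; split=> t /= h i; first by move=> _; exact: h.
by apply: h; rewrite /= finset.in_setT.
Qed.

End iid.

Section gaussian_matrix.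
Context (R : realType) (m n : nat).

(* [measurableTypeR R] is the carrier on which [normal_prob] lives; its measurable
   sets are convertible to those of the canonical structure of [R] (only the
   displays differ), and matrices are over the latter. *)
Definition mx_of_tuple (t : (m * n).-tuple (measurableTypeR R)) : 'M[R]_(m, n) :=
  \matrix_(i, j) tnth t (mxvec_index i j).

Lemma measurable_mx_of_tuple : measurable_fun setT mx_of_tuple.
Proof.
apply/measurable_fun_matrixP => i j; under eq_fun do rewrite mxE.
exact: (@measurable_tnth _ (measurableTypeR R)).
Qed.

HB.instance Definition _ :=
  isMeasurableFun.Build _ _ _ _ mx_of_tuple measurable_mx_of_tuple.

(* The law of E, with i.i.d. N(0,1) entries; see [noise_box]. The second argument
   of [normal_prob] is the standard deviation. *)
Definition noise : probability 'M[R]_(m, n) R :=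
  distribution (iid_prob (normal_prob (0 : R) 1) (m * n)) mx_of_tuple.

Lemma noise_box (B : 'I_m -> 'I_n -> set R) :
  (forall i j, measurable (B i j)) ->
  noise [set E | forall i j, B i j (E i j)] =
  (\prod_(i < m) \prod_(j < n) normal_prob (0 : R) 1 (B i j))%E.
Proof.
move=> mB; pose B' (k : 'I_(m * n)) :=
  let: (i, j) := enum_val (cast_ord (esym (mxvec_cast m n)) k) in B i j.
have B'E i j : B' (mxvec_index i j) = B i j.
  by rewrite /B' /mxvec_index cast_ordK enum_rankK.
have /= hB : mx_of_tuple @^-1` [set E | forall i j, B i j (E i j)] =
    [set t | forall k, B' k (tnth t k)].
  apply/seteqP; split=> t /= h => [k|i j].
    by case/mxvec_indexP: k => i j; rewrite B'E; have := h i j; rewrite mxE.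
  by rewrite mxE -B'E.
transitivity (iid_prob (normal_prob (0 : R) 1) (m * n)
  (mx_of_tuple @^-1` [set E | forall i j, B i j (E i j)])) => //; rewrite hB.
rewrite iid_prob_box; last by case/mxvec_indexP=> i j; rewrite B'E; exact: mB.
rewrite pair_bigA/= (reindex (uncurry (@mxvec_index m n)))/=; last first.
  exact: (curry_mxvec_bij m n).
by apply: eq_bigr => -[i j] _ /=; rewrite B'E.
Qed.

Definition add_signal (X E : 'M[R]_(m, n)) : 'M[R]_(m, n) := X + E.

Lemma measurable_add_signal X : measurable_fun setT (add_signal X).
Proof.
apply/measurable_fun_matrixP => i j; under eq_fun do rewrite mxE.
apply: measurable_realfun.measurable_funD; first exact: measurable_cst.
exact: measurable_coeff.
Qed.

HB.instance Definition _ X :=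
  isMeasurableFun.Build _ _ _ _ (add_signal X) (measurable_add_signal X).

(* The law of Y = X + E. *)
Definition law (X : 'M[R]_(m, n)) : probability 'M[R]_(m, n) R :=
  distribution noise (add_signal X).

End gaussian_matrix.

Section minimax_testing.
Context (R : realType) (d1 d2 s1 s2 : nat).

Definition Theta (mu : R) : set 'M[R]_(d1, d2) :=
  [set M | exists (S1 : {set 'I_d1}) (S2 : {set 'I_d2}),
    [/\ #|S1| = s1, #|S2| = s2,
        (forall i j, i \in S1 -> j \in S2 -> mu <= M i j) &
        (forall i j, ~~ ((i \in S1) && (j \in S2)) -> M i j = 0)]].

Definition test := {mfun 'M[R]_(d1, d2) >-> bool}.

Local Open Scope ereal_scope.

Definition risk (Delta : test) (mu : R) : \bar R :=
  law 0%R [set Y | Delta Y = true] +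
  ereal_sup [set law X [set Y | Delta Y = false] | X in Theta mu].

(* Valued in [\bar R], so that it is [+oo] if no [mu] is admissible. *)
Definition minimax_rate (eta : R) : \bar R :=
  ereal_inf [set mu%:E | mu in
    [set mu : R | (0 < mu)%R /\
      ereal_inf (range (fun Delta : test => risk Delta mu)) < eta%:E]].

End minimax_testing.

(* Main.v *)
(** Upper bound: reject when the sum of all entries is large, or when the sum
    over some [s1] x [s2] submatrix is large. Both are instances of a scan over
    finitely many directions, controlled by the Gaussian Chernoff bound.

    Lower bound: the risk is at least one minus the square root of the chi-square
    divergence of a mixture from the null. The signal is [mu] times the indicator
    of a random rectangle whose row set picks one index in each of [s1] disjoint
    blocks of size [q1 = d1 %/ s1], and similarly for columns. Compared with
    uniform subsets, this makes the overlaps [H1], [H2] of two independent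
    rectangles exactly binomial, and the chi-square divergence is
    [E exp (mu^2 H1 H2) - 1]. Integrating out [H1] leaves
    [E exp (N1 (exp (mu^2 H2) - 1))] with [N1 = s1 / q1]. Where [mu^2 H2 <= 1] the
    inner exponential is linearized, which uses [mu^2 N1 N2 << 1]; where
    [mu^2 H2 > 1] it is at most linear in [H2] with slope [theta], and a Chernoff
    bound on [H2] wins because [theta] is small compared with
    [ln (1 / (mu^2 N2))]. The last comparison rests on [s1 ln (d1/s1)] and
    [s2 ln (d2/s2)] being of the same order and on the log log condition. *)

Require Import Defs.
From HB Require Import structures.
From mathcomp Require Import all_boot all_order all_algebra.
From mathcomp Require Import all_classical all_reals all_analysis.
From mathcomp Require Import measurable_realfun ring lra.

Set Implicit Arguments.
Unset Strict Implicit.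
Unset Printing Implicit Defensive.

Import Order.TTheory GRing.Theory Num.Theory.
Import numFieldNormedType.Exports.

Local Open Scope ring_scope.

(** * Real inequalities *)

Section second_moment_bound.
Context {R : realType}.
Local Notation E := (expR 1 : R).

(** Multiplying [1 - x <= expR (- x)] by [expR x] gives [expR x - 1 <= x * expR x], and
    [expR x <= E] on the unit interval. *)
Lemma expR_sub1_le (x : R) : 0 <= x <= 1 -> expR x - 1 <= E * x.
Proof.
move=> /andP[x0 x1].
have h : 1 - x <= expR (- x) by rewrite -[leLHS]/(1 + - x); exact: expR_ge1Dx.
have : expR x * (1 - x) <= 1.
  by rewrite -[leRHS](expRxMexpNx_1 x) ler_wpM2l// expR_ge0.
have : expR x * x <= E * x by rewrite ler_wpM2r// ler_expR.
lra.
Qed.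

(** [expR x / x] is nondecreasing from 1 on, since [expR (y - x) >= 1 + (y - x) >= y / x]. *)
Lemma expR_ratio_le (x y : R) : 1 <= x -> x <= y -> y * expR x <= x * expR y.
Proof.
move=> x1 xy; rewrite -{2}(subrK x y) expRD mulrA ler_wpM2r ?expR_ge0//.
have := expR_ge1Dx (y - x) => h.
apply: (@le_trans _ _ (x * (1 + (y - x)))); last by rewrite ler_wpM2l//; lra.
nra.
Qed.

(** With [L = v - ln u], the ratio [v / u] is at most [L + 1], while [ln v <= u] gives
    [L * expR (- u) <= 1]. The exponential factor thus lowers the coefficient of [L] from [2 * K] to
    1, at the price of an additive constant. *)
Lemma ratio_expRN_half_le (K u v : R) : 1 <= K -> 1 <= u -> 1 <= v ->
  ln u <= v -> ln v <= u ->
  2 * K * (v / u) * expR (- (u / 2)) <= (v - ln u) + (K ^+ 2 + 2 * K).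
Proof.
move=> K1 u1 v1 uv vu.
have u0 : 0 < u by lra.
pose L := v - ln u; pose w := expR (- (u / 2)).
have w0 : 0 <= w by exact: expR_ge0.
have w1 : w <= 1 by rewrite -[leRHS]expR0 ler_expR; lra.
have lnu0 : 0 <= ln u by rewrite ln_ge0.
have lnuu : ln u <= u by have := ln_sublinear u0; lra.
have L0 : 0 <= L by rewrite /L; lra.
have Lw : L * w ^+ 2 <= 1.
  rewrite /w -expRM_natl (_ : 2%:R * - (u / 2) = - u); last by field.
  rewrite expRN ler_pdivrMr ?expR_gt0// mul1r.
  apply: (@le_trans _ _ v); first by rewrite /L; lra.
  by rewrite -[v]lnK ?ler_expR// posrE; lra.
have vuL : v / u <= L + 1.
  rewrite ler_pdivrMr//; rewrite /L; nra.
have : 2 * K * (v / u) * w <= 2 * K * (L + 1) * w.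
  by rewrite ler_wpM2r// ler_wpM2l//; lra.
(* AM-GM, to be combined with [L * w ^+ 2 <= 1] *)
have : 2 * K * L * w <= L ^+ 2 * w ^+ 2 + K ^+ 2.
  by have := sqr_ge0 (L * w - K); nra.
have : L ^+ 2 * w ^+ 2 <= L by rewrite expr2 -mulrA ler_piMr.
have : 2 * K * w <= 2 * K by rewrite ler_piMr//; lra.
rewrite -/L -/w; nra.
Qed.

(** [expR (c * s2) <= expR (u / 2)] uses up only half of the decay of [N1], and the balance
    [s1 * u <= K * (s2 * v)] turns [s1 / s2] into [K * v / u]. *)
Lemma tail_slope_le (K delta u v s1 s2 N1 c : R) :
  1 <= K -> 1 <= u -> 1 <= v -> ln u <= v -> ln v <= u ->
  0 < s1 -> 0 < s2 -> s1 * u <= K * (s2 * v) ->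
  0 < N1 -> N1 <= 2 * s1 * expR (- u) ->
  2 * delta <= 1 -> c * s2 <= delta * u ->
  N1 * expR (c * s2) / s2 <= (v - ln u) + (K ^+ 2 + 2 * K).
Proof.
move=> K1 u1 v1 uv vu s10 s20 suv N10 N1le d2 cs2.
have u0 : 0 < u by lra.
apply: le_trans (ratio_expRN_half_le K1 u1 v1 uv vu).
have N1c : N1 * expR (c * s2) <= 2 * s1 * expR (- (u / 2)).
  rewrite (_ : - (u / 2) = - u + u / 2); last by field.
  rewrite expRD mulrA; apply: ler_pM; rewrite ?expR_ge0//; first exact: ltW.
  by rewrite ler_expR (le_trans cs2)//; clear -u0 d2; nra.
rewrite ler_pdivrMr//; apply: (le_trans N1c).
rewrite [leRHS]mulrAC ler_wpM2r ?expR_ge0//.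
rewrite (_ : 2 * K * (v / u) * s2 = 2 * (K * (s2 * v)) / u); last first.
  by field; rewrite gt_eqF.
by rewrite ler_pdivlMr//; clear -suv; lra.
Qed.

(** The hypotheses combine to [c * N2 <= 2 * delta * u * expR (- v)]. The term [v - ln u] is shared
    with [tail_slope_le], so this logarithm exceeds that slope by at least [- ln (2 * delta)] minus
    a constant depending on [K]. *)
Lemma tail_ln_ge (delta u v s2 N2 c : R) :
  0 < u -> 0 < delta -> 0 < N2 -> N2 <= 2 * s2 * expR (- v) ->
  0 < c -> c * s2 <= delta * u ->
  v - ln u - ln (2 * delta) <= ln (c^-1 / N2).
Proof.
move=> u0 d0 N20 N2le c0 cs2.
have ud0 : 0 < u * (2 * delta) by rewrite !mulr_gt0.
have -> : v - ln u - ln (2 * delta) = ln (expR v / (u * (2 * delta))).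
  by rewrite ln_div ?posrE ?expR_gt0// expRK [ln (u * _)]lnM ?posrE ?mulr_gt0// opprD addrA.
rewrite ler_ln ?posrE ?divr_gt0 ?invr_gt0 ?expR_gt0//.
rewrite ler_pdivrMr// -invfM mulrC ler_pdivlMr ?mulr_gt0//.
have cN2 : c * N2 <= u * (2 * delta) * expR (- v).
  apply: (le_trans (ler_wpM2l (ltW c0) N2le)).
  by have := ler_wpM2r (expR_ge0 (- v)) cs2; lra.
have := ler_wpM2l (expR_ge0 v) cN2; rewrite [leRHS]mulrCA expRxMexpNx_1.
lra.
Qed.

(** [ln v <= u] gives [v * expR (- u) <= 1], hence [N1 * c <= 2 * delta] and a slope in the unit
    interval. The three factors [E] come from the slope itself, from linearizing [expR a - 1], and
    from linearizing the outer exponential. *)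
Lemma linear_part_le (delta u v s1 s2 N1 N2 c : R) :
  1 <= v -> ln v <= u ->
  0 < N1 -> N1 <= 2 * s1 * expR (- u) -> 0 < N2 -> N2 <= 2 * s2 * expR (- v) ->
  0 < c -> c * s1 <= delta * v ->
  c * (s1 * expR (- u)) * (s2 * expR (- v)) <= delta ->
  0 < delta -> 4 * E ^+ 2 * delta <= 1 ->
  expR (N2 * (expR (E * N1 * c) - 1)) <= 1 + 4 * E ^+ 3 * delta.
Proof.
move=> v1 vu N10 N1le N20 N2le c0 cs1 css d0 dE2.
have E1 : 1 <= E by rewrite -[leLHS](@expR0 R) ler_expR.
have E0 : 0 < E by lra.
set a := E * N1 * c.
have Ed : 2 * E * delta <= 1.
  apply: le_trans dE2; rewrite ler_wpM2r//; first exact: ltW.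
  by clear -E1; nra.
have a1 : 0 <= a <= 1.
  apply/andP; split; first by rewrite /a !mulr_ge0// ltW.
  have vle : v * expR (- u) <= 1.
    rewrite expRN ler_pdivrMr ?expR_gt0// mul1r.
    by rewrite -[v]lnK ?ler_expR// posrE; lra.
  have : N1 * c <= 2 * delta.
    apply: (@le_trans _ _ (2 * (c * s1) * expR (- u))).
      by have := ler_wpM2r (ltW c0) N1le; clear; lra.
    apply: (@le_trans _ _ (2 * (delta * v) * expR (- u))).
      by rewrite ler_wpM2r ?expR_ge0// ler_wpM2l//.
    by have := ler_wpM2l (ltW d0) vle; clear; lra.
  by rewrite /a => /(ler_wpM2l (ltW E0)); clear -Ed; lra.
have aN2 : N2 * (E * a) <= 4 * E ^+ 2 * delta.
  have : N1 * N2 <= (2 * s1 * expR (- u)) * (2 * s2 * expR (- v)).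
    by apply: ler_pM => //; exact: ltW.
  move=> /(ler_wpM2l (ltW c0)) h.
  have : c * (N1 * N2) <= 4 * delta by apply: le_trans h _; clear -css; lra.
  by move=> /(ler_wpM2l (sqr_ge0 E)); rewrite /a; clear; lra.
have : N2 * (expR a - 1) <= 4 * E ^+ 2 * delta.
  by apply: le_trans aN2; rewrite ler_wpM2l ?expR_sub1_le// ltW.
rewrite -ler_expR => /le_trans; apply.
have : expR (4 * E ^+ 2 * delta) - 1 <= E * (4 * E ^+ 2 * delta).
  by apply: expR_sub1_le; rewrite dE2 andbT !mulr_ge0 ?expR_ge0// ltW.
by rewrite (_ : E * _ = 4 * E ^+ 3 * delta); [clear; lra|ring].
Qed.

(** A nonzero overlap is at least 1, so [1 < c * h] forces [h0 <= h], and there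
    [expR (t * (h - h0)) >= 1] is a free Chernoff factor. Monotonicity of [expR x / x] up to
    [c * s2] makes the exponent at most linear in [h]. *)
Lemma expR_overlap_split (N1 c s2 h0 t h : R) :
  0 < N1 -> 0 < c -> 0 < s2 -> h0 = Num.max c^-1 1 -> 0 <= t ->
  h = 0 \/ 1 <= h -> h <= s2 ->
  expR (N1 * (expR (c * h) - 1)) <= expR (E * N1 * c * h) +
    expR (- (t * h0)) * expR ((t + N1 * expR (c * s2) / s2) * h).
Proof.
move=> N10 c0 s20 -> t0 h1 hs2; set theta := N1 * _ / _.
have hge0 : 0 <= h by case: h1 => [->|]//; lra.
have [ch|ch] := leP (c * h) 1.
  rewrite -[leLHS]addr0; apply: lerD; last by rewrite mulr_ge0 ?expR_ge0.
  rewrite ler_expR; have : expR (c * h) - 1 <= E * (c * h).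
    by apply: expR_sub1_le; rewrite ch mulr_ge0// ltW.
  by move=> /(ler_wpM2l (ltW N10)); clear; lra.
have h1' : 1 <= h by case: h1 => // h1; move: ch; rewrite h1; lra.
have hh0 : Num.max c^-1 1 <= h.
  by rewrite ge_max h1' andbT -(ler_pM2l c0) mulfV ?gt_eqF// ltW.
rewrite -[leLHS]add0r; apply: lerD; first exact: expR_ge0.
rewrite -expRD ler_expR.
have thh : N1 * (expR (c * h) - 1) <= theta * h.
  have hs : s2 * expR (c * h) <= h * expR (c * s2).
    have := expR_ratio_le (ltW ch) (ler_wpM2l (ltW c0) hs2).
    by rewrite -!(mulrA c) (ler_pM2l c0).
  rewrite (_ : theta * h = N1 * (h * expR (c * s2) / s2)); last by rewrite /theta; ring.
  apply: ler_wpM2l; first exact: ltW.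
  by rewrite ler_pdivlMr//; clear -hs s20; lra.
by have := ler_wpM2l t0 hh0; clear -thh; lra.
Qed.

(* The first term bounds the linearized part, via [expR x - 1 <= E * x]; the
   second one comes from the Chernoff bound. *)
Definition chi2_const (K : R) : R := 4 * E ^+ 3 + 2 * E * expR (K ^+ 2 + 2 * K).

(* Here [u = ln (d1 / s1)], [v = ln (d2 / s2)], [Ni = si / qi], [c = mu ^+ 2],
   and [h] is the overlap of the column sets: [expR (a * h)] covers the range
   [c * h <= 1] and [C * expR (b * h)] the range [1 < c * h]. *)
Lemma overlap_bound (K delta eps u v s1 s2 N1 N2 c : R) :
  1 <= K -> 1 <= u -> 1 <= v -> ln u <= v -> ln v <= u ->
  0 < s1 -> 0 < s2 -> s1 * u <= K * (s2 * v) ->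
  0 < N1 -> N1 <= 2 * s1 * expR (- u) ->
  0 < N2 -> N2 <= 2 * s2 * expR (- v) ->
  0 < c -> c * s2 <= delta * u -> c * s1 <= delta * v ->
  c * (s1 * expR (- u)) * (s2 * expR (- v)) <= delta ->
  0 < eps -> eps < 1 -> 0 < delta -> delta * chi2_const K <= eps ^+ 2 ->
  exists a b C : R,
    [/\ 0 <= C,
        forall h, h = 0 \/ 1 <= h -> h <= s2 ->
          expR (N1 * (expR (c * h) - 1)) <= expR (a * h) + C * expR (b * h) &
        expR (N2 * (expR a - 1)) + C * expR (N2 * (expR b - 1)) <= 1 + eps ^+ 2].
Proof.
move=> K1 u1 v1 uv vu s10 s20 suv N10 N1le N20 N2le c0 cs2 cs1 css eps0 eps1 d0 dW.
have E1 : 1 <= E by rewrite -[leLHS](@expR0 R) ler_expR.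
have E0 : 0 < E by lra.
have u0 : 0 < u by lra.
have v0 : 0 < v by lra.
have e21 : eps ^+ 2 < 1 by rewrite expr_lt1// ltW.
pose dE := 2 * E * delta * expR (K ^+ 2 + 2 * K).
have dW' : 4 * E ^+ 3 * delta + dE <= eps ^+ 2.
  by rewrite (le_trans _ dW)// /chi2_const /dE; clear; lra.
have dE0 : 0 <= dE by rewrite /dE !mulr_ge0 ?expR_ge0// ltW.
have dE30 : 0 <= 4 * E ^+ 3 * delta by rewrite !mulr_ge0 ?exprn_ge0// ltW.
have dE2 : 4 * E ^+ 2 * delta <= 1.
  apply: (@le_trans _ _ (4 * E ^+ 3 * delta)); last by clear -dW' dE0 e21; lra.
  by rewrite ler_wpM2r ?(ltW d0)// ler_wpM2l// ler_weXn2l.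
have d2 : 2 * delta <= 1.
  apply: le_trans dE2; rewrite ler_wpM2r ?(ltW d0)//.
  by have := exprn_ege1 2 E1; clear; lra.
pose theta := N1 * expR (c * s2) / s2.
pose h0 := Num.max c^-1 1.
(* [b = t + theta = ln (h0 / N2)] minimizes the Chernoff exponent
   [- (b - theta) * h0 + N2 * (expR b - 1)]. *)
pose t := ln (h0 / N2) - theta.
have h01 : 1 <= h0 by rewrite /h0 le_max lexx orbT.
have h00 : 0 < h0 by exact: lt_le_trans h01.
have expt : expR (1 - t) <= dE.
  have -> : dE = expR (1 + ln (2 * delta) + (K ^+ 2 + 2 * K)).
    by rewrite 2!expRD lnK ?posrE ?mulr_gt0// /dE; clear; ring.
  have h0c : ln (c^-1 / N2) <= ln (h0 / N2).
    rewrite ler_ln ?posrE ?divr_gt0 ?invr_gt0//.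
    by rewrite ler_wpM2r ?invr_ge0 ?(ltW N20)// /h0 le_max lexx.
  have := tail_slope_le K1 u1 v1 uv vu s10 s20 suv N10 N1le d2 cs2.
  have := tail_ln_ge u0 d0 N20 N2le c0 cs2.
  by rewrite ler_expR -/theta /t; clear -h0c; lra.
have t1 : 1 < t.
  by rewrite -subr_lt0 -ltr_expR expR0; clear -expt dW' dE30 e21; lra.
have t0 : 0 <= t by clear -t1; lra.
exists (E * N1 * c), (t + theta), (expR (- (t * h0))); split.
- exact: expR_ge0.
- by move=> h h1 hs2; exact: expR_overlap_split.
- have -> : expR (N2 * (expR (t + theta) - 1)) = expR (h0 - N2).
    rewrite /t subrK lnK ?posrE ?divr_gt0//; congr expR.
    by clear -N20; field; rewrite gt_eqF.
  rewrite -expRD.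
  (* The exponent is [h0 * (1 - t) - N2]; since [1 - t < 0], it grows when [h0 >= 1] is replaced by
     1. *)
  have : expR (- (t * h0) + (h0 - N2)) <= expR (1 - t).
    by rewrite ler_expR; clear -t1 h01 N20; nra.
  have := linear_part_le v1 vu N10 N1le N20 N2le c0 cs1 css d0 dE2.
  by clear -expt dW'; lra.
Qed.

End second_moment_bound.

(** * Overlaps of random selections *)

Section overlap.
Context {R : realType} (s q d : nat).
Implicit Types f g : {ffun 'I_s -> 'I_q}.

Definition overlap f g : nat := #|[set i | f i == g i]|.

Lemma overlap_le f g : (overlap f g <= s)%N.
Proof. by rewrite -[leqRHS]card_ord max_card. Qed.

(** Up to the factor [q ^ s], this is a binomial moment generating function: the coordinates of a
    uniform [g] agree with those of [f] independently, so the sum factors. *)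
Lemma sum_expR_overlap f (l : R) :
  \sum_g expR (l * (overlap f g)%:R) = (expR l + q%:R - 1) ^+ s.
Proof.
under eq_bigr => g _.
  rewrite (_ : expR _ = \prod_i (if f i == g i then expR l else 1)); last first.
    rewrite -big_mkcond/= prodr_const /overlap mulrC expRM_natl.
    by rewrite cardsE.
  over.
rewrite -(bigA_distr_bigA (fun i a => if f i == a then expR l else 1))/=.
under eq_bigr => i _.
  rewrite (bigD1 (f i))//= eqxx (eq_bigr (fun=> 1)); last first.
    by move=> a /negbTE; rewrite eq_sym => ->.
  rewrite sumr_const cardC1 card_ord.
  over.
(* For [s = 0], [q] may vanish but both sides are empty products; otherwise a value of [f] witnesses
   [0 < q]. *)
have [->|q0] := posnP s; first by rewrite big_ord0 expr0.
rewrite prodr_const card_ord; congr (_ ^+ _).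
have : (0 < q)%N by case: (f (Ordinal q0)) => m; case: q.
by move=> q1; rewrite -[q in RHS](prednK q1) -natr1; ring.
Qed.

(** [1 + x <= expR x] replaces the binomial generating function by that of a Poisson variable of
    mean [s / q]. *)
Lemma sum_expR_overlap_le f (l : R) : (0 < q)%N ->
  \sum_g expR (l * (overlap f g)%:R) <=
  #|{ffun 'I_s -> 'I_q}|%:R * expR (s%:R / q%:R * (expR l - 1)).
Proof.
move=> q0; rewrite sum_expR_overlap card_ffun !card_ord natrX.
rewrite -mulrA expRM_natl -exprMn; have q0' : 0 < q%:R :> R by rewrite ltr0n.
apply: lerXn2r; rewrite ?nnegrE.
- rewrite -addrA addr_ge0 ?expR_ge0// subr_ge0 ler1n//.
- by rewrite mulr_ge0 ?expR_ge0// ltW.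
apply: (@le_trans _ _ (q%:R * (1 + q%:R^-1 * (expR l - 1)))); last first.
  by rewrite ler_wpM2l ?expR_ge1Dx// ltW.
by rewrite mulrDr mulrA mulfV ?gt_eqF//; lra.
Qed.

Hypothesis sqd : (s * q <= d)%N.

Lemma block_subproof : (#|{: 'I_s * 'I_q}| <= d)%N.
Proof. by rewrite card_prod !card_ord. Qed.

(** The pairs with first component [i] form the [i]-th block; any injection would serve. *)
Definition block (p : 'I_s * 'I_q) : 'I_d :=
  widen_ord block_subproof (enum_rank p).

Lemma block_inj : injective block.
Proof.
by move=> p p' /(congr1 val)/= e; apply: enum_rank_inj; exact: val_inj.
Qed.

Definition selection f : {set 'I_d} := [set block (i, f i) | i : 'I_s].

Lemma card_selection f : #|selection f| = s.
Proof. by rewrite card_imset ?card_ord// => i j /block_inj[]. Qed.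

Lemma card_selectionI f g : #|selection f :&: selection g| = overlap f g.
Proof.
rewrite (_ : _ :&: _ = [set block (i, f i) | i in [set i | f i == g i]]).
  by rewrite card_imset// => i j /block_inj[].
apply/setP => k; rewrite inE; apply/andP/imsetP => [[]|[i]].
  move=> /imsetP[i _ ->] /imsetP[j _ /block_inj[ij fg]].
  by exists i => //; rewrite inE fg ij.
rewrite inE => /eqP fg ->; split; apply/imsetP; exists i => //.
by rewrite fg.
Qed.

End overlap.

(** * Gaussian change of measure *)

Section normal_shift.
Local Open Scope classical_set_scope.
Context {R : realType}.
Notation mu := (@lebesgue_measure R).
Local Open Scope ereal_scope.

(** The Radon-Nikodym derivative agrees almost everywhere with [normal_pdf], both having the same
    integral over every measurable set. *)
Lemma ge0_integral_normal_prob (m s : R) (f : measurableTypeR R -> \bar R) :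
  measurable_fun setT f -> (forall x, 0 <= f x) ->
  \int[normal_prob m s]_x f x = \int[mu]_x (f x * (normal_pdf m s x)%:E).
Proof.
move=> mf f0; have dom := normal_prob_dominates m s.
rewrite -(Radon_Nikodym_SigmaFinite.change_of_variables dom)//.
apply: ae_eq_integral => //.
- apply: emeasurable_funM => //.
  exact: measurable_int (Radon_Nikodym_SigmaFinite.f_integrable dom).
- apply: emeasurable_funM => //; apply/measurable_EFinP.
  exact: measurable_normal_pdf.
- apply: ae_eqe_mul2l => /=; apply: integral_ae_eq => //=.
  + exact: Radon_Nikodym_SigmaFinite.f_integrable.
  + by apply/measurable_EFinP; exact: measurable_normal_pdf.
  + by move=> E _ mE; rewrite -(Radon_Nikodym_SigmaFinite.f_integral dom).
Qed.

Definition translate (a : R) (x : measurableTypeR R) : measurableTypeR R :=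
  (x + a)%R.

Lemma measurable_translate a : measurable_fun setT (translate a).
Proof. exact: (@measurable_funD _ (measurableTypeR R)). Qed.

HB.instance Definition _ a :=
  isMeasurableFun.Build _ _ _ _ (translate a) (measurable_translate a).

Lemma lebesgue_measure_translate (a : R) (A : set R) : measurable A ->
  pushforward mu (translate a) A = mu A.
Proof.
move=> mA; apply/esym/lebesgue_measure_unique => //= _ [[b c]] _ <-.
rewrite /pushforward (_ : _ @^-1` _ = `](b - a)%R, (c - a)%R]%classic); last first.
  by apply/seteqP; split => x /=; rewrite !in_itv/= ltrBlDr lerBrDr.
rewrite !lebesgue_measure_itv/= !lte_fin ltrD2r; case: ifP => // _.
by rewrite -!EFinD; congr _%:E; lra.
Qed.

Lemma ge0_integral_translate (a : R) (f : measurableTypeR R -> \bar R) :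
  measurable_fun setT f -> (forall x, 0 <= f x) ->
  \int[mu]_x f (x + a)%R = \int[mu]_x f x.
Proof.
move=> mf f0.
rewrite [RHS](_ : _ = \int[pushforward mu (translate a)]_x f x); last first.
  apply: eq_measure_integral => A mA _.
  exact/esym/lebesgue_measure_translate.
by rewrite ge0_integral_pushforward.
Qed.

(** One-dimensional Cameron-Martin formula: the exponential is the ratio of the densities of
    [N(a, 1)] and [N(0, 1)]. *)
Lemma ge0_integral_normal_shift (a : R) (f : measurableTypeR R -> \bar R) :
  measurable_fun setT f -> (forall x, 0 <= f x) ->
  \int[normal_prob 0 1]_x f (x + a)%R =
  \int[normal_prob 0 1]_x ((expR (a * x - a ^+ 2 / 2))%:E * f x).
Proof.
move=> mf f0.
have mfa : measurable_fun setT (fun x : measurableTypeR R => f (x + a)%R).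
  exact: measurableT_comp mf (measurable_translate a).
have mE : measurable_fun setT
  (fun x : measurableTypeR R => (expR (a * x - a ^+ 2 / 2))%:E).
  apply/measurable_EFinP; apply: measurableT_comp => //.
  apply: (@measurable_funB _ _ _ _ (fun x : measurableTypeR R => a * x)%R) => //.
  exact: (@measurable_funM _ _ _ _ (cst a)).
have mp : measurable_fun setT
  (fun x : measurableTypeR R => (normal_pdf 0 1 x)%:E).
  by apply/measurable_EFinP; exact: measurable_normal_pdf.
rewrite !ge0_integral_normal_prob//; last 2 first.
- exact: emeasurable_funM.
- by move=> x; rewrite mule_ge0// lee_fin expR_ge0.
(* Translating the right side puts [f (x + a)] under both integrals, leaving an identity between
   densities. *)
rewrite -[RHS](ge0_integral_translate a)//; last 2 first.
- by apply: emeasurable_funM => //; exact: emeasurable_funM.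
- by move=> x; rewrite !mule_ge0// lee_fin ?expR_ge0// normal_pdf_ge0.
apply: eq_integral => x _; rewrite [RHS]muleAC -EFinM muleC; congr (_%:E * _).
rewrite !normal_pdfE ?oner_eq0//= mulrCA -expRD; congr (_ * expR _)%R.
by field.
Qed.

End normal_shift.

Section tuple_shift.
Local Open Scope classical_set_scope.
Context {R : realType}.
Local Open Scope ereal_scope.
Notation T := (measurableTypeR R).

Definition translate_tuple n (a : 'I_n -> R) (t : n.-tuple T) : n.-tuple T :=
  [tuple (tnth t i + a i)%R | i < n].

Lemma measurable_translate_tuple n (a : 'I_n -> R) :
  measurable_fun setT (translate_tuple a).
Proof.
apply/measurable_fun_tnthP => i.
rewrite (_ : _ \o _ = translate (a i) \o (@tnth _ T ^~ i)); last first.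
  by apply/funext => t /=; rewrite tnth_mktuple.
exact: (measurableT_comp (measurable_translate (a i)) (measurable_tnth i)).
Qed.

Lemma translate_tuple_cons n (a : 'I_n.+1 -> R) (z : T * n.-tuple T) :
  translate_tuple a (tuple_cons z) =
  tuple_cons (translate (a ord0) z.1, translate_tuple (a \o lift ord0) z.2).
Proof.
apply: eq_from_tnth => i; rewrite tnth_mktuple /tuple_cons/=.
case: (unliftP ord0 i) => [j|] ->; last by [].
by rewrite !tnthS tnth_mktuple.
Qed.

Definition lik_tuple n (a : 'I_n -> R) (t : n.-tuple T) : R :=
  expR (\sum_(i < n) (a i * tnth t i - a i ^+ 2 / 2)).

Lemma measurable_lik_tuple n (a : 'I_n -> R) :
  measurable_fun setT (lik_tuple a).
Proof.
apply: measurableT_comp => //; apply: measurable_sum => i.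
apply: (@measurable_funB _ _ _ _ (fun t : n.-tuple T => a i * tnth t i)%R) => //.
apply: (@measurable_funM _ _ _ _ (cst (a i))) => //.
exact: (@measurable_tnth _ T).
Qed.

Lemma lik_tuple_cons n (a : 'I_n.+1 -> R) (z : T * n.-tuple T) :
  lik_tuple a (tuple_cons z) =
  (expR (a ord0 * z.1 - a ord0 ^+ 2 / 2) * lik_tuple (a \o lift ord0) z.2)%R.
Proof.
rewrite /lik_tuple big_ord_recl expRD; congr (_ * expR _)%R.
by apply: eq_bigr => i _; rewrite tnthS.
Qed.

Lemma ge0_integral_iid_shift n (a : 'I_n -> R) (f : n.-tuple T -> \bar R) :
  measurable_fun setT f -> (forall t, 0 <= f t) ->
  \int[iid_prob (normal_prob 0 1) n]_t f (translate_tuple a t) =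
  \int[iid_prob (normal_prob 0 1) n]_t ((lik_tuple a t)%:E * f t).
Proof.
elim: n a f => [|n IHn] a f mf f0.
  apply: eq_integral => t _; rewrite /lik_tuple big_ord0 expR0 mul1e.
  by congr f; rewrite (tuple0 t) (tuple0 (translate_tuple _ _)).
have mc : measurable_fun setT (@tuple_cons _ T n) by exact: measurable_tuple_cons.
have mfs : measurable_fun setT (f \o translate_tuple a).
  exact: measurableT_comp mf (measurable_translate_tuple a).
have ml : measurable_fun setT (fun t => (lik_tuple a t)%:E).
  by apply/measurable_EFinP; exact: measurable_lik_tuple.
have mlf : measurable_fun setT (fun t => (lik_tuple a t)%:E * f t).
  exact: emeasurable_funM.
pose N : probability T R := normal_prob 0 1.
have iidS (g : n.+1.-tuple T -> \bar R) : measurable_fun setT g ->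
    (forall t, 0 <= g t) ->
    \int[iid_prob N n.+1]_t g t =
    \int[N]_x \int[iid_prob N n]_t g (tuple_cons (x, t)).
  move=> mg g0 /=; rewrite ge0_integral_pushforward// preimage_setT.
  rewrite fubini_tonelli1//; last by move=> z; exact: g0.
  exact: (measurableT_comp mg).
rewrite !iidS//; last by move=> t; rewrite mule_ge0 ?lee_fin ?expR_ge0.
(* [F] integrates out all coordinates but the first, already weighted by their likelihood ratio; the
   one-dimensional shift is then applied to [F]. *)
pose F x := \int[iid_prob N n]_t
  ((lik_tuple (a \o lift ord0) t)%:E * f (tuple_cons (x, t))).
have mlf' : measurable_fun setT (fun z : T * n.-tuple T =>
    (lik_tuple (a \o lift ord0) z.2)%:E * f (tuple_cons z)).
  apply: emeasurable_funM; last exact: measurableT_comp mf mc.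
  apply/measurable_EFinP.
  exact: measurableT_comp (measurable_lik_tuple _) measurable_snd.
have F0 x : 0 <= F x.
  by apply: integral_ge0 => t _; rewrite mule_ge0 ?lee_fin ?expR_ge0.
have mF : measurable_fun setT F.
  apply: (measurable_fun_fubini_tonelli_F _ mlf') => z.
  by rewrite mule_ge0 ?lee_fin ?expR_ge0.
transitivity (\int[N]_x F (x + a ord0)%R).
  apply: eq_integral => x _.
  under eq_integral do rewrite translate_tuple_cons.
  rewrite (IHn (a \o lift ord0)
    (fun t => f (tuple_cons (translate (a ord0) x, t))))//.
  exact: measurableT_comp mf (measurableT_comp mc (pair1_measurable _)).
rewrite ge0_integral_normal_shift//; apply: eq_integral => x _.
rewrite -ge0_integralZl ?lee_fin ?expR_ge0//; last 2 first.
- exact: measurableT_comp mlf' (pair1_measurable _).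
- by move=> t _; rewrite mule_ge0 ?lee_fin ?expR_ge0.
by apply: eq_integral => t _; rewrite lik_tuple_cons EFinM muleA.
Qed.

End tuple_shift.

(** * Likelihood ratios and Gaussian tails for matrices *)

Section matrix_shift.
Local Open Scope classical_set_scope.
Context {R : realType} (m n : nat).
Local Open Scope ereal_scope.
Implicit Types X Y : 'M[R]_(m, n).

Definition mxdot X Y : R := (\sum_i \sum_j X i j * Y i j)%R.

Lemma mxdotC X Y : mxdot X Y = mxdot Y X.
Proof.
by apply: eq_bigr => i _; apply: eq_bigr => j _; rewrite mulrC.
Qed.

Lemma mxdotDr X Y Z : mxdot X (Y + Z) = (mxdot X Y + mxdot X Z)%R.
Proof.
rewrite -big_split; apply: eq_bigr => i _; rewrite -big_split.
by apply: eq_bigr => j _; rewrite mxE mulrDr.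
Qed.

Lemma mxdotZr (c : R) X Y : mxdot X (c *: Y) = (c * mxdot X Y)%R.
Proof.
rewrite mulr_sumr; apply: eq_bigr => i _; rewrite mulr_sumr.
by apply: eq_bigr => j _; rewrite mxE mulrCA.
Qed.

Lemma mxdotZl (c : R) X Y : mxdot (c *: X) Y = (c * mxdot X Y)%R.
Proof. by rewrite mxdotC mxdotZr mxdotC. Qed.

Lemma measurable_mxdot X : measurable_fun setT (mxdot X).
Proof.
apply: measurable_sum => i; apply: measurable_sum => j.
apply: (@measurable_funM _ _ _ _ (cst (X i j))) => //.
exact: measurable_coeff.
Qed.

(* The density of [law X] with respect to [law 0]; see [ge0_integral_law]. *)
Definition lik X Y : R := expR (mxdot X Y - mxdot X X / 2).

Lemma measurable_lik X : measurable_fun setT (lik X).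
Proof.
apply: measurableT_comp => //.
by apply: measurable_funB => //; exact: measurable_mxdot.
Qed.

Lemma lik_gt0 X Y : (0 < lik X Y)%R.
Proof. exact: expR_gt0. Qed.

Lemma ge0_integral_noise (f : 'M[R]_(m, n) -> \bar R) :
  measurable_fun setT f -> (forall Y, 0 <= f Y) ->
  \int[noise R m n]_Y f Y =
  \int[iid_prob (normal_prob 0 1) (m * n)]_t f (mx_of_tuple t).
Proof.
move=> mf f0.
by rewrite ge0_integral_pushforward// preimage_setT.
Qed.

Lemma ge0_integral_law X (f : 'M[R]_(m, n) -> \bar R) :
  measurable_fun setT f -> (forall Y, 0 <= f Y) ->
  \int[law X]_Y f Y = \int[noise R m n]_Y ((lik X Y)%:E * f Y).
Proof.
move=> mf f0; rewrite ge0_integral_pushforward// preimage_setT.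
have ml : measurable_fun setT (fun Y => (lik X Y)%:E).
  by apply/measurable_EFinP; exact: measurable_lik.
rewrite !ge0_integral_noise//; last 4 first.
- exact: measurableT_comp mf (measurable_add_signal X).
- by move=> Y; exact: f0.
- exact: emeasurable_funM.
- by move=> Y; rewrite mule_ge0// lee_fin ltW// lik_gt0.
pose a k := mxvec X ord0 k.
transitivity (\int[iid_prob (normal_prob 0 1) (m * n)]_t
    f (mx_of_tuple (translate_tuple a t))).
  apply: eq_integral => t _ /=; congr f; apply/matrixP => i j.
  by rewrite /add_signal !mxE tnth_mktuple /a mxvecE addrC.
rewrite (@ge0_integral_iid_shift R _ a (f \o @mx_of_tuple R m n)); last 2 first.
- exact: measurableT_comp mf (@measurable_mx_of_tuple R m n).
- by move=> t; exact: f0.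
apply: eq_integral => t _ /=; congr ((expR _)%:E * _).
rewrite /mxdot mulr_suml -sumrB; under [RHS]eq_bigr do rewrite mulr_suml -sumrB.
rewrite pair_bigA/= [LHS](reindex (uncurry (@mxvec_index m n)))/=; last first.
  exact: (curry_mxvec_bij m n).
by apply: eq_bigr => -[i j] _ /=; rewrite /a mxvecE mxE.
Qed.

Lemma integral_lik X : \int[noise R m n]_Y (lik X Y)%:E = 1.
Proof.
rewrite -(probability_setT (law X)) -(mul1e (law X setT)) -integral_cst//.
by rewrite ge0_integral_law//; apply: eq_integral => Y _; rewrite mule1.
Qed.

Lemma law0 : law (0 : 'M[R]_(m, n)) = noise R m n :> (set _ -> \bar R).
Proof.
apply/funext => A; rewrite /law /distribution/= /pushforward; congr (_ _).
by apply/seteqP; split => Y /=; rewrite /add_signal add0r.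
Qed.

Lemma lawE X A : measurable A -> law X A = \int[noise R m n]_(Y in A) (lik X Y)%:E.
Proof.
move=> mA; rewrite -(setIT A) -integral_indic//.
rewrite ge0_integral_law//; last first.
  by apply/measurable_EFinP; exact: measurable_indic.
by rewrite [RHS]integral_mkcond/= setIT -epatch_indic.
Qed.

(** Completing the square: since [lik (X + X')] integrates to 1, only [expR (mxdot X X')] survives
    in the cross moments of the chi-square divergence. *)
Lemma likM X X' Y :
  (lik X Y * lik X' Y = expR (mxdot X X') * lik (X + X') Y)%R.
Proof.
rewrite /lik -!expRD mxdotDr !(mxdotC (X + X')) !mxdotDr (mxdotC X' X) !(mxdotC Y).
by congr expR; field.
Qed.

Lemma integral_likM X X' : \int[noise R m n]_Y (lik X Y * lik X' Y)%:E =
  (expR (mxdot X X'))%:E.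
Proof.
under eq_integral do rewrite likM EFinM.
rewrite ge0_integralZl ?integral_lik ?mule1 ?lee_fin ?expR_ge0//.
- by apply/measurable_EFinP; exact: measurable_lik.
- by move=> Y _; rewrite lee_fin ltW// lik_gt0.
Qed.

Lemma measurable_ge_mxdot X (t : R) :
  measurable [set Y : 'M[R]_(m, n) | t <= mxdot X Y]%R.
Proof.
rewrite (_ : mkset _ = mxdot X @^-1` `[t, +oo[%classic).
  by rewrite -[X in measurable X]setTI; exact: measurable_mxdot.
by apply/seteqP; split => Y /=; rewrite in_itv/= andbT.
Qed.

(** Exponential Markov inequality by change of measure: on the event, [lik X] is at least
    [expR (t - mxdot X X / 2)], and its integral there is a probability under [law X]. *)
Lemma noise_ge_mxdot X (t : R) :
  noise R m n [set Y : 'M[R]_(m, n) | t <= mxdot X Y]%R <=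
  (expR (mxdot X X / 2 - t))%:E.
Proof.
set A := (X in noise _ _ _ X); have mA : measurable A := measurable_ge_mxdot X t.
have : (expR (t - mxdot X X / 2))%:E * noise R m n A <= 1.
  rewrite -integral_cst//.
  apply: (@le_trans _ _ (law X A)); last exact: probability_le1.
  rewrite lawE//; apply: ge0_le_integral => //.
  - by move=> Y _; rewrite lee_fin expR_ge0.
  - by apply/measurable_funTS/measurable_EFinP; exact: measurable_lik.
  - by move=> Y AY; rewrite lee_fin ler_expR lerB.
rewrite -lee_pdivlMl ?expR_gt0// mule1 => /le_trans; apply.
by rewrite lee_fin -expRN ler_expR; lra.
Qed.

Lemma noise_mxdot_tail X (t : R) : (0 <= t)%R -> (0 < mxdot X X)%R ->
  noise R m n [set Y : 'M[R]_(m, n) | t <= mxdot X Y]%R <=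
  (expR (- (t ^+ 2 / (2 * mxdot X X))))%:E.
Proof.
move=> t0 X0; pose c := (t / mxdot X X)%R.
have c0 : (0 <= c)%R by rewrite divr_ge0// ltW.
have := noise_ge_mxdot (c *: X) (c * t).
rewrite mxdotZl mxdotZr (_ : _ / 2 - _ = - (t ^+ 2 / (2 * mxdot X X)))%R.
  apply: le_trans; apply: le_measure; rewrite ?inE.
  - exact: measurable_ge_mxdot.
  - exact: measurable_ge_mxdot.
  - by move=> Y /= tY; rewrite mxdotZl ler_wpM2l.
by rewrite /c; field; rewrite gt_eqF.
Qed.

End matrix_shift.

(** * Scan tests *)

Section scan_test.
Local Open Scope classical_set_scope.
Context {R : realType} (d1 d2 : nat).
Local Open Scope ereal_scope.
Notation M := 'M[R]_(d1, d2).

Definition scan (s : seq M) (t : R) (Y : M) : bool :=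
  has (fun V => t <= mxdot V Y)%R s.

Lemma measurable_scan s t : measurable_fun setT (scan s t).
Proof.
elim: s => [|V s IHs] /=; first exact: measurable_cst.
apply: measurable_or => //; apply: (measurable_fun_bool true).
by rewrite setTI; exact: measurable_ge_mxdot.
Qed.

HB.instance Definition _ s t :=
  isMeasurableFun.Build _ _ _ _ (scan s t) (measurable_scan s t).

Lemma measurable_scan_eq s t b : measurable [set Y | scan s t Y = b].
Proof.
have := @measurable_scan s t measurableT [set b] Logic.I.
by rewrite setTI.
Qed.

Lemma noise_scan (s : seq M) (t D : R) : (0 <= t)%R -> (0 < D)%R ->
  (forall V, V \in s -> mxdot V V = D) ->
  noise R d1 d2 [set Y | scan s t Y = true] <=
  ((size s)%:R * expR (- (t ^+ 2 / (2 * D))))%:E.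
Proof.
move=> t0 D0; elim: s => [|V s IHs] sD.
  by rewrite (_ : [set Y | _] = set0) ?measure0 ?mul0r// -subset0 => Y.
have sD' W : W \in s -> mxdot W W = D.
  by move=> Ws; apply: sD; rewrite inE Ws orbT.
rewrite (_ : [set Y | _] = [set Y : M | t <= mxdot V Y]%R `|`
    [set Y | scan s t Y = true]); last first.
  by apply/seteqP; split => Y /= /orP.
apply: (le_trans (measureU2 _ _ _)).
- exact: measurable_ge_mxdot.
- exact: measurable_scan_eq.
rewrite [size _]/= -nat1r mulrDl mul1r EFinD.
apply: leeD; last exact: IHs.
have VD : mxdot V V = D by rewrite sD ?mem_head.
by rewrite -VD noise_mxdot_tail// VD.
Qed.

(** The union bound on false alarms costs [size s] terms. The extra one pays for misses: the signal
    contributes at least [2 * t] along some [V], so a miss forces the noise below [- t] there, a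
    tail event for [- V]. *)
Lemma scan_risk (s1 s2 : nat) (mu : R) (s : seq M) (t D : R) :
  (0 <= t)%R -> (0 < D)%R ->
  (forall V, V \in s -> mxdot V V = D) ->
  (forall X, @Theta R d1 d2 s1 s2 mu X -> exists2 V, V \in s & 2 * t <= mxdot V X)%R ->
  risk s1 s2 (scan s t) mu <=
  (((size s).+1)%:R * expR (- (t ^+ 2 / (2 * D))))%:E.
Proof.
move=> t0 D0 sD sT.
rewrite /risk law0 -natr1 mulrDl mul1r EFinD; apply: leeD.
  exact: noise_scan.
apply: ge_ereal_sup => _ [X TX <-]; have [V Vs tV] := sT _ TX.
rewrite -(sD V)//.
have V' : mxdot (- V) (- V) = mxdot V V.
  by rewrite -scaleN1r mxdotZl mxdotZr; ring.
rewrite -V'; apply: le_trans (noise_mxdot_tail t0 _); last by rewrite V' sD.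
rewrite (_ : law X _ =
  noise R d1 d2 (add_signal X @^-1` [set Y | scan s t Y = false]))//.
apply: le_measure; rewrite ?inE.
- rewrite -[X in measurable X]setTI.
  apply: measurable_add_signal => //; exact: measurable_scan_eq.
- exact: measurable_ge_mxdot.
- move=> Y /=; rewrite /add_signal => /negbT/hasPn/(_ V Vs).
  rewrite -ltNge mxdotDr => VY; rewrite -scaleN1r mxdotZl; lra.
Qed.

End scan_test.

(** * The chi-square lower bound on the risk *)

Section chi2.
Local Open Scope classical_set_scope.
Local Open Scope ereal_scope.

(** A weighted AM-GM inequality, applied pointwise and then integrated, does the work of
    Cauchy-Schwarz on [\1_B * (1 - L)]. *)
Lemma probability_le_integral_chi2 d (T : measurableType d) (R : realType)
    (P : probability T R) (L : T -> R) (B : set T) (eps : R) :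
  measurable B -> measurable_fun setT L -> (forall x, 0 <= L x)%R ->
  (0 < eps)%R -> \int[P]_x (L x)%:E = 1 ->
  \int[P]_x (L x ^+ 2)%:E <= (1 + eps ^+ 2)%:E ->
  P B <= \int[P]_(x in B) (L x)%:E + eps%:E.
Proof.
move=> mB mL L0 eps0 L1 L2.
have mLE : measurable_fun setT (fun x => (L x)%:E) by apply/measurable_EFinP.
have mL2 : measurable_fun setT (fun x => (L x ^+ 2)%:E).
  by apply/measurable_EFinP; exact: measurable_funX.
have mLB : measurable_fun setT (fun x => (L x * \1_B x)%:E).
  by apply/measurable_EFinP; apply: measurable_funM => //; exact: measurable_indic.
have mBE : measurable_fun setT (fun x => (\1_B x : R)%:E).
  by apply/measurable_EFinP; exact: measurable_indic.
have i0 : (0 <= eps^-1)%R by rewrite invr_ge0 ltW.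
have h0 : (0 <= (2 * eps)^-1)%R by rewrite invr_ge0 mulr_ge0// ltW.
(* [\1_B * (1 - L) <= ((L - 1) ^+ 2 + eps ^+ 2) / (2 * eps)], rearranged so that
   both sides are nonnegative *)
have : \int[P]_x ((\1_B x : R)%:E + eps^-1%:E * (L x)%:E) <=
    \int[P]_x ((L x * \1_B x)%:E +
      ((2 * eps)^-1%:E * (L x ^+ 2)%:E + ((2 * eps)^-1 + eps / 2)%:E)).
  apply: ge0_le_integral => //.
  - by move=> x _; rewrite adde_ge0// ?mule_ge0 ?lee_fin.
  - by apply: emeasurable_funD => //; exact: measurable_funeM.
  - by do 2 apply: emeasurable_funD => //; exact: measurable_funeM.
  move=> x _; rewrite -!EFinM -!EFinD lee_fin -subr_ge0.
  set l := L x; rewrite indicE; case: (x \in B) => /=.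
    rewrite (_ : _ - _ = (l - 1 + eps) ^+ 2 / (2 * eps))%R; last first.
      by field; rewrite gt_eqF.
    by rewrite mulr_ge0// sqr_ge0.
  rewrite (_ : _ - _ = ((l - 1) ^+ 2 + eps ^+ 2) / (2 * eps))%R; last first.
    by field; rewrite gt_eqF.
  by rewrite mulr_ge0// addr_ge0// sqr_ge0.
have intBL : \int[P]_x (L x * \1_B x)%:E = \int[P]_(x in B) (L x)%:E.
  rewrite [RHS]integral_mkcond/=; apply: eq_integral => x _.
  by rewrite patchE indicE; case: ifP => _; rewrite ?mulr1 ?mulr0.
rewrite ge0_integralD//; last 2 first.
- by move=> x _; rewrite mule_ge0 ?lee_fin.
- exact: measurable_funeM.
rewrite ge0_integralZl//; last by move=> x _; rewrite lee_fin.
rewrite integral_indic// setIT L1 mule1.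
rewrite ge0_integralD//; last 3 first.
- by move=> x _; rewrite lee_fin mulr_ge0.
- move=> x _; rewrite -EFinM -EFinD lee_fin addr_ge0 ?addr_ge0//.
    by rewrite mulr_ge0// sqr_ge0.
  by rewrite divr_ge0// ltW.
- by apply: emeasurable_funD => //; exact: measurable_funeM.
rewrite intBL ge0_integralD//; last 3 first.
- by move=> x _; rewrite -EFinM lee_fin mulr_ge0// sqr_ge0.
- exact: measurable_funeM.
- by move=> x _; rewrite lee_fin addr_ge0// divr_ge0// ltW.
rewrite ge0_integralZl//; last by move=> x _; rewrite lee_fin sqr_ge0.
have intc (c : R) : \int[P]_x c%:E = c%:E.
  rewrite integral_cst// -[RHS]mule1; congr (_ * _); exact: probability_setT.
rewrite intc => PB.
(* The term [eps^-1] is the integral of [eps^-1 * L], and [(2 * eps)^-1 * (1 + eps ^+ 2) + (2 *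
   eps)^-1 + eps / 2 = eps^-1 + eps]. *)
rewrite -(@leeD2rE _ eps^-1%:E)//; apply: (le_trans PB).
rewrite -(addeA _ eps%:E) -EFinD; apply: leeD2l.
apply: (@le_trans _ _ ((2 * eps)^-1%:E * (1 + eps ^+ 2)%:E +
    ((2 * eps)^-1 + eps / 2)%:E)).
  by apply: leeD2r; apply: lee_wpmul2l; rewrite ?lee_fin.
rewrite -EFinM -EFinD lee_fin le_eqVlt; apply/orP; left; apply/eqP.
by field; rewrite gt_eqF.
Qed.

End chi2.

Section lower_bound.
Local Open Scope classical_set_scope.
Context {R : realType} (d1 d2 s1 s2 : nat).
Local Open Scope ereal_scope.

(** The density [L] of the uniform mixture has the displayed double sum as second moment. The worst
    miss probability is at least the mean one, which is within [eps] of the null probability of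
    accepting. *)
Lemma risk_ge (I : finType) (X : I -> 'M[R]_(d1, d2)) (mu eps : R)
    (Delta : test R d1 d2) :
  (0 < eps)%R -> (0 < #|I|)%N -> (forall i, Theta s1 s2 mu (X i)) ->
  ((#|I|%:R ^+ 2)^-1 * \sum_i \sum_j expR (mxdot (X i) (X j)) <= 1 + eps ^+ 2)%R ->
  (1 - eps)%:E <= risk s1 s2 Delta mu.
Proof.
move=> eps0 I0 XT chi.
pose N : R := #|I|%:R; have N0 : (0 < N)%R by rewrite ltr0n.
pose L Y : R := (N^-1 * \sum_i lik (X i) Y)%R.
have mS : measurable_fun setT (fun Y => \sum_i lik (X i) Y)%R.
  by apply: measurable_sum => i; exact: measurable_lik.
have mL : measurable_fun setT L.
  exact: (@measurable_funM _ _ _ _ (cst N^-1%R)).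
have L0 Y : (0 <= L Y)%R.
  apply: mulr_ge0; first by rewrite invr_ge0 ltW.
  by apply: sumr_ge0 => i _; exact/ltW/lik_gt0.
have intL D : measurable D ->
    \int[noise R d1 d2]_(Y in D) (L Y)%:E = N^-1%:E * \sum_i law (X i) D.
  move=> mD; under eq_integral do rewrite EFinM.
  rewrite ge0_integralZl//; first last.
  - by rewrite lee_fin invr_ge0 ltW.
  - by move=> Y _; rewrite lee_fin; apply: sumr_ge0 => i _; exact/ltW/lik_gt0.
  - by apply/measurable_funTS/measurable_EFinP.
  congr (_ * _); under eq_integral do rewrite -sumEFin.
  rewrite ge0_integral_sum//; first last.
  - by move=> i Y _; rewrite lee_fin; exact/ltW/lik_gt0.
  - by move=> i; apply/measurable_funTS/measurable_EFinP; exact: measurable_lik.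
  by apply: eq_bigr => i _; rewrite lawE.
pose B := [set Y | Delta Y = false].
have mB : measurable B.
  have := @measurable_funPT _ _ _ _ Delta measurableT [set false] Logic.I.
  by rewrite setTI.
have : noise R d1 d2 B <= N^-1%:E * \sum_i law (X i) B + eps%:E.
  rewrite -intL//; apply: probability_le_integral_chi2 => //.
    rewrite intL//; under eq_bigr do rewrite probability_setT.
    rewrite sumEFin sumr_const -EFinM cardE -cardE mulVf//.
    by rewrite gt_eqF.
  apply: (@le_trans _ _ ((N ^+ 2)^-1 *
    \sum_i \sum_j expR (mxdot (X i) (X j)))%:E); last by rewrite lee_fin.
  have L2E Y : (L Y ^+ 2)%:E =
      ((N ^+ 2)^-1)%:E * \sum_(p : I * I) (lik (X p.1) Y * lik (X p.2) Y)%:E.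
    rewrite sumEFin -EFinM; congr _%:E; rewrite /L exprMn exprVn; congr (_ * _)%R.
    by rewrite expr2 big_distrlr/= pair_bigA.
  under eq_integral do rewrite L2E.
  have mlik p : measurable_fun setT
      (fun Y => (lik (X p.1) Y * lik (X p.2) Y)%:E).
    by apply/measurable_EFinP; apply: measurable_funM; exact: measurable_lik.
  have lik0 p Y : 0 <= (lik (X p.1) Y * lik (X p.2) Y)%:E.
    by rewrite lee_fin mulr_ge0// ltW// lik_gt0.
  rewrite ge0_integralZl//; first last.
  - by rewrite lee_fin invr_ge0 sqr_ge0.
  - by move=> Y _; apply: sume_ge0.
  - by apply: emeasurable_sum => p; exact: mlik.
  rewrite ge0_integral_sum//; under eq_bigr do rewrite integral_likM.
  by rewrite sumEFin -EFinM (pair_bigA _ (fun i j => expR (mxdot (X i) (X j)))).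
rewrite /risk law0; set S := ereal_sup _.
have BS : N^-1%:E * \sum_i law (X i) B <= S.
  apply: (@le_trans _ _ (N^-1%:E * (N%:E * S))); last first.
    by rewrite muleA -EFinM mulVf ?mul1e// gt_eqF.
  apply: lee_wpmul2l; first by rewrite lee_fin invr_ge0 ltW.
  apply: (@le_trans _ _ (\sum_(i : I) S)).
    by apply: lee_sum => i _; apply: ereal_sup_ubound; exists (X i).
  by rewrite sumr_const mule_natl.
rewrite (_ : [set Y | Delta Y = true] = ~` B); last first.
  by apply/seteqP; split => Y; rewrite /B/=; case: (Delta Y).
rewrite probability_setC// => NB.
have {NB BS} : noise R d1 d2 B <= S + eps%:E by exact: (le_trans NB (leeD2r _ BS)).
have /fineK <- : noise R d1 d2 B \is a fin_num by exact: fin_num_measure.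
set b := fine _; case: S => [s| |].
- by rewrite -EFinB -!EFinD !lee_fin => ?; lra.
- by move=> _; rewrite -EFinB addey ?leey.
- by rewrite addNye.
Qed.

End lower_bound.

(** * Rectangular signals *)

Section rect.
Context {R : realType} (d1 d2 : nat).

Definition rect (mu : R) (S1 : {set 'I_d1}) (S2 : {set 'I_d2}) : 'M[R]_(d1, d2) :=
  \matrix_(i, j) (mu *+ ((i \in S1) && (j \in S2))).

Lemma mxdot_rect mu S1 S2 (Y : 'M[R]_(d1, d2)) :
  mxdot (rect mu S1 S2) Y = mu * \sum_(i in S1) \sum_(j in S2) Y i j.
Proof.
rewrite mulr_sumr [RHS]big_mkcond/=; apply: eq_bigr => i _.
case: ifP => iS; last by rewrite big1// => j _; rewrite mxE iS mul0r.
rewrite mulr_sumr [RHS]big_mkcond/=; apply: eq_bigr => j _.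
by rewrite mxE iS/=; case: ifP => _; rewrite ?mul0r.
Qed.

Lemma sum_rect mu S1 S2 (T1 : {set 'I_d1}) (T2 : {set 'I_d2}) :
  \sum_(i in T1) \sum_(j in T2) rect mu S1 S2 i j =
  mu * (#|T1 :&: S1| * #|T2 :&: S2|)%:R.
Proof.
transitivity (\sum_(i in T1 :&: S1) \sum_(j in T2 :&: S2) mu).
  rewrite [RHS]big_mkcond/= [LHS]big_mkcond/=; apply: eq_bigr => i _; rewrite inE.
  case: (i \in T1) => //=; case: ifP => iS; last first.
    by rewrite big1// => j _; rewrite mxE iS.
  rewrite [RHS]big_mkcond/= [LHS]big_mkcond/=; apply: eq_bigr => j _; rewrite inE.
  by case: (j \in T2) => //=; rewrite mxE iS/=; case: ifP.
by under eq_bigr do rewrite sumr_const; rewrite sumr_const -mulrnA mulr_natr mulnC.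
Qed.

Lemma mxdot_rect_rect mu S1 S2 T1 T2 :
  mxdot (rect mu S1 S2) (rect mu T1 T2) =
  mu ^+ 2 * (#|S1 :&: T1| * #|S2 :&: T2|)%:R.
Proof. by rewrite mxdot_rect sum_rect mulrA. Qed.

Lemma rect_Theta s1 s2 mu (S1 : {set 'I_d1}) (S2 : {set 'I_d2}) :
  #|S1| = s1 -> #|S2| = s2 -> Theta s1 s2 mu (rect mu S1 S2).
Proof.
move=> cS1 cS2; exists S1, S2; split=> // i j; last by rewrite mxE => /negbTE ->.
by move=> i1 j2; rewrite mxE i1 j2.
Qed.

End rect.

(** * Lower bound on the risk for weak signals *)

Section lower.
Context {R : realType}.

(** The row sum is taken first, at fixed column overlap; after the split, the column generating
    function is evaluated at [a] and [b]. *)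
Lemma sum_expR_overlap_mul (s1 q1 s2 q2 : nat) (f : {ffun 'I_s1 -> 'I_q1})
    (g : {ffun 'I_s2 -> 'I_q2}) (c a b C B : R) :
  (0 < q1)%N -> (0 < q2)%N -> 0 <= C ->
  (forall h : R, h = 0 \/ 1 <= h -> h <= s2%:R ->
     expR (s1%:R / q1%:R * (expR (c * h) - 1)) <= expR (a * h) + C * expR (b * h)) ->
  expR (s2%:R / q2%:R * (expR a - 1)) + C * expR (s2%:R / q2%:R * (expR b - 1)) <= B ->
  \sum_(p : {ffun 'I_s1 -> 'I_q1} * {ffun 'I_s2 -> 'I_q2})
     expR (c * (overlap f p.1 * overlap g p.2)%:R) <=
  #|{: {ffun 'I_s1 -> 'I_q1} * {ffun 'I_s2 -> 'I_q2}}|%:R * B.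
Proof.
move=> q1_gt0 q2_gt0 C0 split_le sum_le.
rewrite -(pair_bigA _ (fun f' g' => expR (c * (overlap f f' * overlap g g')%:R)))/=.
rewrite exchange_big/= card_prod natrM.
apply: (@le_trans _ _ (\sum_(g' : {ffun 'I_s2 -> 'I_q2})
    #|{ffun 'I_s1 -> 'I_q1}|%:R * (expR (a * (overlap g g')%:R) +
      C * expR (b * (overlap g g')%:R)))).
  apply: ler_sum => g' _.
  under eq_bigr do rewrite mulnC natrM mulrA.
  apply: le_trans (sum_expR_overlap_le f _ q1_gt0) _; rewrite ler_wpM2l//.
  apply: split_le; last by rewrite ler_nat overlap_le.
  by case: (overlap g g') => [|k]; [left|right; rewrite ler1n].
rewrite -mulr_sumr big_split/= -mulr_sumr -mulrA ler_wpM2l//.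
apply: (@le_trans _ _ (#|{ffun 'I_s2 -> 'I_q2}|%:R *
    (expR (s2%:R / q2%:R * (expR a - 1)) +
     C * expR (s2%:R / q2%:R * (expR b - 1))))); last by rewrite ler_wpM2l.
rewrite mulrDr mulrCA lerD// ?ler_wpM2l//; exact: sum_expR_overlap_le.
Qed.

(** Rounding [d / s] down loses at most a factor 2, because the quotient is at least 1. *)
Lemma block_ratio (s d : nat) : (0 < s <= d)%N ->
  s%:R / (d %/ s)%:R <= 2 * s%:R * expR (- ln (d%:R / s%:R)) :> R.
Proof.
move=> /andP[s0 sd]; have d0 : (0 < d)%N := leq_trans s0 sd.
have q0 : (0 < d %/ s)%N by rewrite divn_gt0.
have s0' : 0 < s%:R :> R by rewrite ltr0n.
have d0' : 0 < d%:R :> R by rewrite ltr0n.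
rewrite expRN lnK ?posrE ?divr_gt0// invf_div ler_pdivrMr ?ltr0n//.
have : d%:R <= 2 * (d %/ s)%:R * s%:R :> R.
  rewrite -!natrM ler_nat -mulnA mul2n -addnn.
  by rewrite [leqLHS](divn_eq d s) leq_add2l ltnW// (leq_trans (ltn_pmod _ s0))// leq_pmull.
move=> h; rewrite (_ : _ * _ * _ = s%:R * (2 * (d %/ s)%:R * s%:R / d%:R)).
  by rewrite ler_peMr ?ler_pdivlMr ?mul1r// ltW.
by field; rewrite gt_eqF.
Qed.

Lemma risk_ge_small_signal (K eps mu : R) (s1 s2 d1 d2 : nat) (Delta : test R d1 d2) :
  (0 < s1 <= d1)%N -> (0 < s2 <= d2)%N -> 1 <= K ->
  let u : R := ln (d1%:R / s1%:R) in
  let v : R := ln (d2%:R / s2%:R) in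
  1 <= u -> 1 <= v -> ln u <= v -> ln v <= u ->
  s1%:R * u <= K * (s2%:R * v) ->
  0 < eps < 1 -> 0 < mu ->
  forall delta, 0 < delta -> delta * chi2_const K <= eps ^+ 2 ->
  mu ^+ 2 * s2%:R <= delta * u -> mu ^+ 2 * s1%:R <= delta * v ->
  mu ^+ 2 * (s1%:R ^+ 2 * s2%:R ^+ 2) <= delta * (d1%:R * d2%:R) ->
  ((1 - eps)%:E <= risk s1 s2 Delta mu)%E.
Proof.
move=> sd1 sd2 K1 u v u1 v1 uv vu suv /andP[eps0 eps1] mu0 delta d0 dW mu1 mu2 mu3.
have /andP[s10 sd1'] := sd1; have /andP[s20 sd2'] := sd2.
pose q1 := (d1 %/ s1)%N; pose q2 := (d2 %/ s2)%N.
have q10 : (0 < q1)%N by rewrite divn_gt0.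
have q20 : (0 < q2)%N by rewrite divn_gt0.
have sq1 : (s1 * q1 <= d1)%N by rewrite mulnC leq_trunc_div.
have sq2 : (s2 * q2 <= d2)%N by rewrite mulnC leq_trunc_div.
have s10' : 0 < s1%:R :> R by rewrite ltr0n.
have s20' : 0 < s2%:R :> R by rewrite ltr0n.
have d10' : 0 < d1%:R :> R by rewrite ltr0n (leq_trans s10).
have d20' : 0 < d2%:R :> R by rewrite ltr0n (leq_trans s20).
have [||||||||||||a [b [C [C0 split_le sum_le]]]] :=
  @overlap_bound R K delta eps u v s1%:R s2%:R (s1%:R / q1%:R) (s2%:R / q2%:R)
    (mu ^+ 2) K1 u1 v1 uv vu s10' s20' suv.
- by rewrite divr_gt0// ltr0n.
- exact: block_ratio.
- by rewrite divr_gt0// ltr0n.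
- exact: block_ratio.
- by rewrite exprn_gt0.
- by [].
- by [].
- rewrite /u /v !expRN !lnK ?posrE ?divr_gt0// !invf_div.
  rewrite (_ : _ * _ = mu ^+ 2 * (s1%:R ^+ 2 * s2%:R ^+ 2) / (d1%:R * d2%:R)).
    by rewrite ler_pdivrMr// mulr_gt0.
  by field; rewrite !gt_eqF.
- by [].
- by [].
- by [].
- by [].
pose I := ({ffun 'I_s1 -> 'I_q1} * {ffun 'I_s2 -> 'I_q2})%type.
pose X (p : I) := rect mu (selection sq1 p.1) (selection sq2 p.2).
have I0 : (0 < #|{: I}|)%N.
  by rewrite card_prod !card_ffun !card_ord muln_gt0 !expn_gt0 q10 q20.
apply: (@risk_ge R d1 d2 s1 s2 I X) => //.
  by move=> p; apply: rect_Theta; exact: card_selection.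
have I0' : 0 < #|{: I}|%:R :> R by rewrite ltr0n.
rewrite mulrC ler_pdivrMr ?exprn_gt0//.
(* The inner sum is bounded uniformly in the first selection, so the outer sum only contributes its
   number of terms. *)
apply: (@le_trans _ _ (\sum_(p : I) #|{: I}|%:R * (1 + eps ^+ 2))).
  apply: ler_sum => p _.
  under eq_bigr do rewrite mxdot_rect_rect !card_selectionI.
  exact: sum_expR_overlap_mul split_le sum_le.
by rewrite sumr_const -[leLHS]mulr_natl le_eqVlt; apply/orP; left; apply/eqP; ring.
Qed.

End lower.

(** * Upper bound: risks of the two tests *)

Section upper.
Context {R : realType}.

(** For [x = s / d], a single term of the binomial expansion gives ['C(d, s) * x ^+ s <= (1 + x) ^+
    d <= expR s]; then [1 <= u] absorbs [s] into [s * u]. *)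
Lemma bin_le_expR (s d : nat) : (0 < s <= d)%N -> 1 <= ln (d%:R / s%:R) :> R ->
  'C(d, s)%:R <= expR (2 * (s%:R * ln (d%:R / s%:R))) :> R.
Proof.
move=> /andP[s0 sd] u1; have d0 : (0 < d)%N := leq_trans s0 sd.
have s0' : 0 < s%:R :> R by rewrite ltr0n.
have d0' : 0 < d%:R :> R by rewrite ltr0n.
set u := ln _ in u1 *.
have uE : expR u = d%:R / s%:R by rewrite lnK// posrE divr_gt0.
pose x : R := s%:R / d%:R; have x0 : 0 <= x by rewrite divr_ge0.
have Cx : 'C(d, s)%:R * x ^+ s <= expR s%:R.
  rewrite (_ : s%:R = d%:R * x); last by rewrite /x; field; rewrite gt_eqF.
  rewrite expRM_natl; apply: (@le_trans _ _ ((1 + x) ^+ d)); last first.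
    by apply: lerXn2r; rewrite ?nnegrE ?expR_ge0 ?addr_ge0 ?expR_ge1Dx.
  rewrite exprDn (bigD1 (inord s : 'I_d.+1))//= inordK ?ltnS//.
  rewrite expr1n mul1r mulr_natl lerDl sumr_ge0// => i _.
  by rewrite mulrn_wge0// mulr_ge0 ?exprn_ge0.
have xs : x ^+ s * expR (s%:R * u) = 1.
  by rewrite expRM_natl uE -exprMn /x mulrA divfK ?gt_eqF// mulfV ?gt_eqF// expr1n.
have := ler_wpM2r (expR_ge0 (s%:R * u)) Cx.
rewrite -mulrA xs mulr1 -expRD => /le_trans; apply; rewrite ler_expR; nra.
Qed.

Lemma Theta_sum (d1 d2 s1 s2 : nat) (mu : R) (X : 'M[R]_(d1, d2)) :
  Theta s1 s2 mu X -> exists (S1 : {set 'I_d1}) (S2 : {set 'I_d2}),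
    [/\ #|S1| = s1, #|S2| = s2,
      mu * (s1 * s2)%:R <= \sum_(i in S1) \sum_(j in S2) X i j &
      \sum_i \sum_j X i j = \sum_(i in S1) \sum_(j in S2) X i j].
Proof.
move=> [S1 [S2 [cS1 cS2 Xge X0]]]; exists S1, S2; split => //.
  apply: (@le_trans _ _ (\sum_(i in S1) \sum_(j in S2) mu)).
    by under eq_bigr do rewrite sumr_const; rewrite sumr_const -mulrnA mulr_natr cS1 cS2 mulnC.
  by apply: ler_sum => i i1; apply: ler_sum => j j2; exact: Xge.
rewrite [RHS]big_mkcond; apply: eq_bigr => i _; case: ifP => iS.
  rewrite [RHS]big_mkcond; apply: eq_bigr => j _; case: ifP => jS//.
  by apply: X0; rewrite iS jS.
by apply: big1 => j _; apply: X0; rewrite iS.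
Qed.

Lemma mxdot_rect1 (d1 d2 : nat) (S1 : {set 'I_d1}) (S2 : {set 'I_d2}) :
  mxdot (rect 1 S1 S2) (rect 1 S1 S2) = (#|S1| * #|S2|)%:R :> R.
Proof. by rewrite mxdot_rect_rect !finset.setIid expr1n mul1r. Qed.

Lemma total_sum_risk (d1 d2 s1 s2 : nat) (mu : R) :
  (0 < d1)%N -> (0 < d2)%N -> 0 < mu ->
  exists Delta : test R d1 d2,
  (risk s1 s2 Delta mu <=
   (2 * expR (- ((mu * (s1 * s2)%:R) ^+ 2 / (8 * (d1 * d2)%:R))))%:E)%E.
Proof.
move=> d10 d20 mu0; pose V : 'M[R]_(d1, d2) := rect 1 [set: 'I_d1] [set: 'I_d2].
(* Half of the least value of [mxdot V X] over the alternative. *)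
pose t := mu * (s1 * s2)%:R / 2.
have D0 : 0 < (d1 * d2)%:R :> R by rewrite ltr0n muln_gt0 d10.
exists (scan [:: V] t).
apply: le_trans (@scan_risk R d1 d2 s1 s2 mu [:: V] t (d1 * d2)%:R _ D0 _ _) _.
- by rewrite /t divr_ge0// mulr_ge0// ltW.
- by move=> W; rewrite inE => /eqP ->; rewrite mxdot_rect1 !cardsT !card_ord.
- move=> X /Theta_sum[S1 [S2 [_ _ XS sumX]]]; exists V; first exact: mem_head.
  rewrite mxdot_rect mul1r (_ : 2 * t = mu * (s1 * s2)%:R); last first.
    by rewrite /t; field.
  apply: (le_trans XS); rewrite -sumX.
  by under [leRHS]eq_bigl do rewrite inE; under [leRHS]eq_bigr do under eq_bigl do rewrite inE.
rewrite lee_fin (_ : t ^+ 2 / (2 * (d1 * d2)%:R) =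
  (mu * (s1 * s2)%:R) ^+ 2 / (8 * (d1 * d2)%:R))//.
by rewrite /t; field; rewrite !pnatr_eq0 -!lt0n d10 d20.
Qed.

Lemma rect_scan_risk (d1 d2 s1 s2 : nat) (mu : R) :
  (0 < s1)%N -> (0 < s2)%N -> 0 < mu ->
  exists Delta : test R d1 d2,
  (risk s1 s2 Delta mu <=
   (('C(d1, s1) * 'C(d2, s2)).+1%:R *
     expR (- (mu ^+ 2 * (s1 * s2)%:R / 8)))%:E)%E.
Proof.
move=> s10 s20 mu0.
pose P := finset.setX [set S : {set 'I_d1} | #|S| == s1]
  [set S : {set 'I_d2} | #|S| == s2].
pose s := [seq (rect 1 p.1 p.2 : 'M[R]_(d1, d2)) | p <- enum P].
pose t := mu * (s1 * s2)%:R / 2.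
have D0 : 0 < (s1 * s2)%:R :> R by rewrite ltr0n muln_gt0 s10.
have ss : size s = ('C(d1, s1) * 'C(d2, s2))%N.
  by rewrite size_map -cardE cardsX !card_draws !card_ord.
exists (scan s t).
apply: le_trans (@scan_risk R d1 d2 s1 s2 mu s t (s1 * s2)%:R _ D0 _ _) _.
- by rewrite /t divr_ge0// mulr_ge0// ltW.
- move=> W /mapP[[S1 S2]]; rewrite mem_enum !inE/= => /andP[/eqP c1 /eqP c2] ->.
  by rewrite mxdot_rect1 c1 c2.
- move=> X /Theta_sum[S1 [S2 [c1 c2 XS _]]]; exists (rect 1 S1 S2).
    by apply/mapP; exists (S1, S2); rewrite // mem_enum !inE/= c1 c2 !eqxx.
  rewrite mxdot_rect mul1r (_ : 2 * t = mu * (s1 * s2)%:R)//.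
  by rewrite /t; field.
rewrite lee_fin ss (_ : t ^+ 2 / (2 * (s1 * s2)%:R) =
  mu ^+ 2 * (s1 * s2)%:R / 8)//.
by rewrite /t; field; rewrite !pnatr_eq0 -!lt0n s10 s20.
Qed.

Lemma exists_test_risk_lt (eta A mu : R) (s1 s2 d1 d2 : nat) :
  (0 < s1 <= d1)%N -> (0 < s2 <= d2)%N ->
  let u : R := ln (d1%:R / s1%:R) in
  let v : R := ln (d2%:R / s2%:R) in
  1 <= u -> 1 <= v -> 0 < eta < 1 -> 8 * (3 + ln (2 / eta)) <= A -> 0 < mu ->
  A * Num.min (d1%:R * d2%:R / (s1%:R ^+ 2 * s2%:R ^+ 2))
      (s2%:R^-1 * u + s1%:R^-1 * v) <= mu ^+ 2 ->
  exists Delta : test R d1 d2, (risk s1 s2 Delta mu < eta%:E)%E.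
Proof.
move=> sd1 sd2 u v u1 v1 /andP[eta0 eta1] A8 mu0 muA.
have /andP[s10 sd1'] := sd1; have /andP[s20 sd2'] := sd2.
have d10 := leq_trans s10 sd1'; have d20 := leq_trans s20 sd2'.
have s10' : 0 < s1%:R :> R by rewrite ltr0n.
have s20' : 0 < s2%:R :> R by rewrite ltr0n.
have d10' : 0 < d1%:R :> R by rewrite ltr0n.
have d20' : 0 < d2%:R :> R by rewrite ltr0n.
have ln0 : 0 <= ln (2 / eta) by rewrite ln_ge0// ler_pdivlMr//; lra.
(* Of the 3 in the lower bound on [A / 8], 2 pays for the logarithm of the number of rectangles and
   1 makes the inequality strict. *)
have small (x : R) : x <= 2 - A / 8 -> 2 * expR x < eta.
  move=> xA; have : expR x < expR (- ln (2 / eta)) by rewrite ltr_expR; lra.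
  rewrite expRN lnK ?posrE ?divr_gt0// invf_div ltr_pdivlMr//; lra.
have [le12|/ltW le21] := leP (d1%:R * d2%:R / (s1%:R ^+ 2 * s2%:R ^+ 2))
  (s2%:R^-1 * u + s1%:R^-1 * v).
  have [Delta D] := @total_sum_risk d1 d2 s1 s2 mu d10 d20 mu0.
  exists Delta; apply: (le_lt_trans D); rewrite lte_fin; apply: small.
  move: muA; rewrite min_l// mulrA ler_pdivrMr ?mulr_gt0 ?exprn_gt0// => muA.
  have : A / 8 <= (mu * (s1 * s2)%:R) ^+ 2 / (8 * (d1 * d2)%:R).
    rewrite ler_pdivlMr ?mulr_gt0 ?ltr0n ?muln_gt0 ?d10//.
    by rewrite !natrM !exprMn; lra.
  lra.
have [Delta D] := @rect_scan_risk d1 d2 s1 s2 mu s10 s20 mu0.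
exists Delta; apply: (le_lt_trans D); rewrite lte_fin.
pose w := s1%:R * u + s2%:R * v.
have s11 : 1 <= s1%:R :> R by rewrite ler1n.
have s21 : 1 <= s2%:R :> R by rewrite ler1n.
have w1 : 1 <= w by rewrite /w; nra.
have Aw : A * w <= mu ^+ 2 * (s1 * s2)%:R.
  move: muA; rewrite min_r// => /(ler_wpM2r (ler0n R (s1 * s2))); apply: le_trans.
  rewrite le_eqVlt; apply/orP; left; apply/eqP.
  by rewrite natrM /w; field; rewrite !gt_eqF.
have N : ('C(d1, s1) * 'C(d2, s2)).+1%:R <= 2 * expR (2 * w) :> R.
  rewrite -natr1 natrM (_ : 2 * expR _ = expR (2 * w) + expR (2 * w)); last by ring.
  apply: lerD.
    rewrite /w mulrDr expRD; apply: ler_pM => //; exact: bin_le_expR.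
  by rewrite -[leLHS]expR0 ler_expR; lra.
(* As [2 - A / 8] is negative and [1 <= w], the exponent [(2 - A / 8) * w] is at most
   [2 - A / 8]. *)
apply: le_lt_trans (small (2 * w - A / 8 * w) _); last by nra.
rewrite expRD mulrA; apply: ler_pM => //; rewrite ?expR_ge0// ler_expR.
lra.
Qed.

End upper.

(** * Two-sided bound on the separation rate *)

Lemma expe2_ge_le (R : realType) (x y : R) (m : \bar R) : 0 <= x -> 0 <= y ->
  ((Num.sqrt x)%:E <= m)%E -> (m <= (Num.sqrt y)%:E)%E ->
  (x%:E <= m ^+ 2 <= y%:E)%E.
Proof.
move=> x0 y0 xm my.
have m0 : (0 <= m)%E by apply: le_trans xm; rewrite lee_fin sqrtr_ge0.
rewrite expe2 -{1}(sqr_sqrtr x0) -{1}(sqr_sqrtr y0) !expr2 !EFinM.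
by apply/andP; split; apply: lee_pmul => //; rewrite lee_fin sqrtr_ge0.
Qed.

Theorem corollary1 (R : realType) (eta K : R)
    (eta_gt0 : 0 < eta) (eta_lt1 : eta < 1) (K_ge1 : 1 <= K) :
  exists A : R, 1 <= A /\
  forall s1 s2 d1 d2 : nat,
    (0 < s1 <= d1)%N -> (0 < s2 <= d2)%N ->
    let r1 : R := d1%:R / s1%:R in
    let r2 : R := d2%:R / s2%:R in
    expR 1 <= Num.min r1 r2 ->
    Num.max (ln (ln r1) / ln r2) (ln (ln r2) / ln r1) <= 1 ->
    K^-1 * (s2%:R * ln r2) <= s1%:R * ln r1 ->
    s1%:R * ln r1 <= K * (s2%:R * ln r2) ->
    let rho : R := Num.min (d1%:R * d2%:R / (s1%:R ^+ 2 * s2%:R ^+ 2))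
                           (s2%:R^-1 * ln r1 + s1%:R^-1 * ln r2) in
    let mustar : \bar R := minimax_rate d1 d2 s1 s2 eta in
    ((A^-1 * rho)%:E <= mustar ^+ 2 <= (A * rho)%:E)%E.
Proof.
have K0 : 0 < K by lra.
pose eps := 1 - eta; pose W := chi2_const K.
have W0 : 0 < W by rewrite /W /chi2_const addr_gt0 ?mulr_gt0 ?exprn_gt0 ?expR_gt0.
have eps0 : 0 < eps by rewrite /eps; lra.
pose delta := eps ^+ 2 / W.
have delta0 : 0 < delta by rewrite divr_gt0 ?exprn_gt0.
(* The first term serves the tests; the second gives [A^-1 * (1 + K) <= delta], as the lower bound
   requires. *)
pose A := Num.max (8 * (3 + ln (2 / eta))) ((1 + K) / delta).
have A8 : 8 * (3 + ln (2 / eta)) <= A by rewrite /A le_max lexx.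
have AK : (1 + K) / delta <= A by rewrite /A le_max lexx orbT.
have A1 : 1 <= A.
  have : 0 <= ln (2 / eta) by rewrite ln_ge0// ler_pdivlMr//; lra.
  by lra.
have A0 : 0 < A by lra.
have AdK : A^-1 * (1 + K) <= delta by rewrite ler_pdivrMl// mulrC -ler_pdivrMl// mulrC.
exists A; split=> // s1 s2 d1 d2 sd1 sd2 r1 r2 er su_div su_ge su_le.
pose rho : R := Num.min (d1%:R * d2%:R / (s1%:R ^+ 2 * s2%:R ^+ 2))
  (s2%:R^-1 * ln r1 + s1%:R^-1 * ln r2).
rewrite -[is_true _]/(is_true ((A^-1 * rho)%:E <=
  minimax_rate d1 d2 s1 s2 eta ^+ 2 <= (A * rho)%:E)%E).
move: er su_div.
rewrite le_min ge_max => /andP[er1 er2].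
have /andP[s10 sd1'] := sd1; have /andP[s20 sd2'] := sd2.
have s10' : 0 < s1%:R :> R by rewrite ltr0n.
have s20' : 0 < s2%:R :> R by rewrite ltr0n.
have d10' : 0 < d1%:R :> R by rewrite ltr0n (leq_trans s10).
have d20' : 0 < d2%:R :> R by rewrite ltr0n (leq_trans s20).
have u1 : 1 <= ln r1 by rewrite -[leLHS](@expRK R) ler_ln ?posrE ?expR_gt0 ?divr_gt0.
have v1 : 1 <= ln r2 by rewrite -[leLHS](@expRK R) ler_ln ?posrE ?expR_gt0 ?divr_gt0.
have u0 : 0 < ln r1 by lra.
have v0 : 0 < ln r2 by lra.
rewrite !ler_pdivrMr// !mul1r => /andP[uv vu].
have rho0 : 0 < rho.
  rewrite /rho lt_min divr_gt0 ?mulr_gt0 ?exprn_gt0//=.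
  by rewrite addr_gt0// mulr_gt0 ?invr_gt0.
apply: expe2_ge_le.
- by rewrite mulr_ge0 ?invr_ge0 ?ltW.
- by rewrite mulr_ge0 ?ltW.
(* Below [Num.sqrt (A^-1 * rho)], every test has risk at least [1 - eps = eta], so no such [mu] is
   admissible. *)
- apply: le_ereal_inf_tmp => _ [mu [mu0 risk_lt] <-]; rewrite lee_fin.
  rewrite leNgt; apply/negP => mu_lt; move: risk_lt; apply/negP; rewrite -leNgt.
  apply: le_ereal_inf_tmp => _ [Delta _ <-].
  have mu2 : mu ^+ 2 <= A^-1 * rho.
    rewrite -[leRHS]sqr_sqrtr; last by rewrite mulr_ge0 ?invr_ge0 ?ltW.
    by rewrite ler_sqr ?nnegrE ?sqrtr_ge0 ?ltW.
  have mu2a : mu ^+ 2 <= A^-1 * (d1%:R * d2%:R / (s1%:R ^+ 2 * s2%:R ^+ 2)).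
    by apply: (le_trans mu2); rewrite ler_wpM2l ?invr_ge0 ?(ltW A0)// ge_min lexx.
  have mu2b : mu ^+ 2 <= A^-1 * (s2%:R^-1 * ln r1 + s1%:R^-1 * ln r2).
    by apply: (le_trans mu2); rewrite ler_wpM2l ?invr_ge0 ?(ltW A0)// ge_min lexx orbT.
  have Ai0 : 0 <= A^-1 by rewrite invr_ge0 ltW.
  rewrite (_ : eta = 1 - eps); last by rewrite /eps; ring.
  apply: (@risk_ge_small_signal R K eps mu s1 s2 d1 d2 Delta sd1 sd2 K_ge1 u1 v1 uv vu
    su_le _ mu0 delta) => //.
  + by rewrite eps0 /eps; lra.
  + by rewrite /delta divfK ?gt_eqF.
  (* Multiplying by [s2] leaves [ln r1 + s2 / s1 * ln r2], and the balance condition bounds the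
     second summand by [K * ln r1]. *)
  + apply: (@le_trans _ _ (A^-1 * (1 + K) * ln r1)); last by rewrite ler_wpM2r// ltW.
    apply: (le_trans (ler_wpM2r (ltW s20') mu2b)); rewrite -!mulrA ler_wpM2l//.
    rewrite mulrDl mulrDl mul1r mulrAC mulVf ?gt_eqF// mul1r lerD2l.
    rewrite -mulrA ler_pdivrMl//; move: su_ge; rewrite ler_pdivrMl//; lra.
  + apply: (@le_trans _ _ (A^-1 * (1 + K) * ln r2)); last by rewrite ler_wpM2r// ltW.
    apply: (le_trans (ler_wpM2r (ltW s10') mu2b)); rewrite -!mulrA ler_wpM2l//.
    rewrite mulrDl mulrDl mul1r [X in _ + X]mulrAC mulVf ?gt_eqF// mul1r addrC lerD2l.
    rewrite -mulrA ler_pdivrMl//; lra.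
  + apply: (@le_trans _ _ (A^-1 * (d1%:R * d2%:R))).
      by rewrite -ler_pdivlMr ?mulr_gt0 ?exprn_gt0// -mulrA.
    rewrite ler_wpM2r ?mulr_ge0// (le_trans _ AdK)// ler_peMr//; lra.
(* The value [Num.sqrt (A * rho)] is itself admissible. *)
- apply: ereal_inf_lbound; exists (Num.sqrt (A * rho)) => //; split.
    by rewrite sqrtr_gt0 mulr_gt0.
  have [|||Delta D] := @exists_test_risk_lt R eta A (Num.sqrt (A * rho)) s1 s2 d1 d2
    sd1 sd2 u1 v1 _ A8.
  + by rewrite eta_gt0 eta_lt1.
  + by rewrite sqrtr_gt0 mulr_gt0.
  + by rewrite sqr_sqrtr// mulr_ge0// ltW.
  by apply: le_lt_trans D; apply: ereal_inf_lbound; exists Delta.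
Qed.
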